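(* Let $G=(S,T,A,B,V,\pi)$ be a nonlocal game that is weakly projective for Bob. Suppose that a shared entangled state $|\psi\rangle\in\mathbb{C}^d\otimes\mathbb{C}^d$ of full Schmidt rank and measurements $\mathcal{E}^{(s)}=\{E^s_i\}_{i\in A}$ ($s\in S$, for Alice) and $\mathcal{F}^{(t)}=\{F^t_i\}_{i\in B}$ ($t\in T$, for Bob) specify a perfect strategy for $G$. Then: (1) the operators $F^t_j$ are projectors for all $t\in T$, $j\in B$; (2) a maximally entangled state $|\Psi\rangle$ can be used in place of $|\psi\rangle$ (that is, a maximally entangled state $|\Psi\rangle\in\mathbb{C}^d\otimes\mathbb{C}^d$ together with the same measurements is a perfect strategy for $G$).
   Context: A (one-round, two-party) nonlocal game $G=(S,T,A,B,V,\pi)$ consists of question sets $S,T$, answer sets $A,B$, a verification function $V$ with values $V(a,b|s,t)\in\{0,1\}$, and a probability distribution $\pi$ on $S\times T$. The verifier draws $(s,t)$ according to $\pi$ and sends $s$ to Alice and $t$ to Bob, who answer $a\in A$ and $b\in B$ without communicating; they win if $V(a,b|s,t)=1$. A measurement on $\mathbb{C}^d$ is a family of positive semidefinite $d\times d$ matrices summing to the identity. In a quantum strategy given by $|\psi\rangle$, $\{E^s_i\}_{i\in A}$ and $\{F^t_j\}_{j\in B}$, Alice measures the first tensor factor and Bob the second, so on questions $(s,t)$ the answers $(a,b)$ occur with probability $\langle\psi|E^s_a\otimes F^t_b|\psi\rangle$. A strategy is perfect if it allows the players to win with probability one. $G$ is weakly projective for Bob if for each $t\in T$ there exist $s\in S$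 and a function $f_{st}:A\to B$ such that $V(a,b|s,t)=1$ if and only if $b=f_{st}(a)$. A state (unit vector) in $\mathbb{C}^d\otimes\mathbb{C}^d$ has a Schmidt decomposition $\sum_{i=1}^d\lambda_i|\alpha_i\rangle|\beta_i\rangle$ with $\lambda_i\ge 0$ and $\{|\alpha_i\rangle\}$, $\{|\beta_i\rangle\}$ orthonormal bases of $\mathbb{C}^d$. It has full Schmidt rank if all $\lambda_i>0$, and is maximally entangled if all its Schmidt coefficients $\lambda_i$ are the same.
   Formalization: Weak projectivity for Bob is taken to require that the question s for each t satisfies π(s,t) > 0; without this the claim fails, since the measurement for a question t that is never asked is arbitrary. *)

(* Defs.v *)
From mathcomp Require Export all_boot all_order all_algebra.
From mathcomp Require Export reals.
From mathcomp Require Export complex.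
From mathcomp.real_closed Require mxtens.
(* Only the constant tensmx: the notation [A ^t k] of mxtens clashes with the
   conjugate transpose [A ^t*] of spectral. *)
Import mxtens(tensmx).

Set Implicit Arguments.
Unset Strict Implicit.
Unset Printing Implicit Defensive.

Import Order.TTheory GRing.Theory Num.Theory.
Local Open Scope ring_scope.
Local Open Scope complex_scope.
Local Open Scope sesquilinear_scope.

Notation "A *t B" := (tensmx A B) (at level 40, left associativity) : ring_scope.

Record nonlocal_game (R : realType) (S T A B : finType) := NonlocalGame {
  verif : A -> B -> S -> T -> bool;
  qdist : S -> T -> R;
  qdist_ge0 : forall s t, 0 <= qdist s t;
  qdist_sum1 : \sum_s \sum_t qdist s t = 1
}.

(* The pair (s, t) is required to be one that the verifier may ask. Otherwise
   V(., . | s, t) does not constrain the players at all, and the measurement of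
   a question t that is never asked would be arbitrary. If qdist has full
   support, the condition [0 < qdist G s t] is automatic. *)
Definition weakly_projective_for_Bob (R : realType) (S T A B : finType)
    (G : nonlocal_game R S T A B) : Prop :=
  forall t : T, exists s : S, 0 < qdist G s t /\
    exists f : A -> B, forall a b, verif G a b s t <-> b = f a.

Section Quantum.
Variable R : realType.
Local Notation C := R[i].

(* In the order of R[i], [0 <= z] says that z is real and nonnegative. *)
Definition psdmx d (M : 'M[C]_d) : Prop :=
  M ^t* = M /\ forall v : 'cV[C]_d, 0 <= (v ^t* *m M *m v) 0 0.

Definition is_projector d (P : 'M[C]_d) : Prop := P ^t* = P /\ P *m P = P.

Definition is_measurement d (I : finType) (E : I -> 'M[C]_d) : Prop :=
  (forall i, psdmx (E i)) /\ \sum_i E i = 1%:M.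

(* C^d (x) C^d is identified with C^(d * d) through the Kronecker product. *)
Definition is_state d (psi : 'cV[C]_(d * d)) : Prop := psi ^t* *m psi = 1%:M.

(* d orthonormal vectors of C^d, hence a basis *)
Definition orthonormal_basis d (alpha : 'I_d -> 'cV[C]_d) : Prop :=
  forall i j, ((alpha i) ^t* *m alpha j) 0 0 = (i == j)%:R.

Definition Schmidt_decomposition d (psi : 'cV[C]_(d * d))
    (lambda : 'I_d -> R) (alpha beta : 'I_d -> 'cV[C]_d) : Prop :=
  [/\ forall i, 0 <= lambda i,
      orthonormal_basis alpha,
      orthonormal_basis beta
    & psi = \sum_i (lambda i)%:C *: (alpha i *t beta i)].

Definition full_Schmidt_rank d (psi : 'cV[C]_(d * d)) : Prop :=
  exists lambda alpha beta,
    Schmidt_decomposition psi lambda alpha beta /\ forall i, 0 < lambda i.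

Definition maximally_entangled d (psi : 'cV[C]_(d * d)) : Prop :=
  is_state psi /\
  exists lambda alpha beta,
    Schmidt_decomposition psi lambda alpha beta /\
    forall i j, lambda i = lambda j.

Definition outcome_prob d (psi : 'cV[C]_(d * d)) (E F : 'M[C]_d) : C :=
  (psi ^t* *m (E *t F) *m psi) 0 0.

Definition winning_prob (S T A B : finType) (G : nonlocal_game R S T A B) d
    (psi : 'cV[C]_(d * d)) (E : S -> A -> 'M[C]_d) (F : T -> B -> 'M[C]_d) : C :=
  \sum_s \sum_t (qdist G s t)%:C *
    \sum_a \sum_(b | verif G a b s t) outcome_prob psi (E s a) (F t b).

Definition perfect_strategy (S T A B : finType) (G : nonlocal_game R S T A B) d
    (psi : 'cV[C]_(d * d)) (E : S -> A -> 'M[C]_d) (F : T -> B -> 'M[C]_d)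
    : Prop :=
  [/\ is_state psi,
      forall s, is_measurement (E s),
      forall t, is_measurement (F t)
    & winning_prob G psi E F = 1].

End Quantum.

(* Main.v *)
(* In the Schmidt bases of psi, with D the diagonal matrix of the Schmidt
   coefficients, X^s_a the matrix of E^s_a and Y^t_b the transpose of the matrix
   of F^t_b, the outcome probabilities are tr(X D Y D). A losing outcome thus
   means tr(X (D Y D)) = 0 with both factors positive semidefinite, that is,
   X D Y = 0. For t and s as in weak projectivity, let Z_b be the sum of the
   X^s_a over f(a) = b. Then Z_b D Y_b' = 0 whenever b <> b', and summing over
   either index gives Z_b D = D Y_b. Taking adjoints, D Z_b = Y_b D, so D^2
   commutes with Y_b, and so does D because it is diagonal and positive. Hence
   Z_b = Y_b and Y_b Y_b' = 0, which makes the Y_b projectors. Finally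
   X D Y = 0 with D Y = Y D gives X Y = 0, so that no losing outcome becomes
   possible when D is replaced by a scalar matrix. *)
Require Import Defs.
From mathcomp Require Import ring.
Set Implicit Arguments.
Unset Strict Implicit.
Unset Printing Implicit Defensive.
Import Order.TTheory GRing.Theory Num.Theory.
Import mxtens.
Local Open Scope ring_scope.
Local Open Scope complex_scope.
Local Open Scope sesquilinear_scope.

(** * Adjoints and the Hilbert-Schmidt norm *)

Lemma adjmxM (C : numClosedFieldType) m n p
    (A : 'M[C]_(m, n)) (B : 'M[C]_(n, p)) :
  (A *m B) ^t* = B ^t* *m A ^t*.
Proof. by rewrite trmx_mul map_mxM. Qed.

Lemma adjmxK (C : numClosedFieldType) m n (A : 'M[C]_(m, n)) : (A ^t*) ^t* = A.
Proof. by apply/matrixP => i j; rewrite !mxE conjCK. Qed.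

Lemma adjmx_tens (C : numClosedFieldType) m n p q
    (A : 'M[C]_(m, n)) (B : 'M[C]_(p, q)) :
  (A *t B) ^t* = A ^t* *t B ^t*.
Proof. by apply/matrixP => i j; rewrite !mxE rmorphM. Qed.

(** This is the squared Hilbert-Schmidt norm of [A]; below, it turns a vanishing trace into a
    vanishing matrix. *)
Lemma mxtrace_mul_adj (C : numClosedFieldType) m n (A : 'M[C]_(m, n)) :
  \tr (A *m A ^t*) = \sum_i \sum_j `|A i j| ^+ 2.
Proof.
apply: eq_bigr => i _; rewrite mxE; apply: eq_bigr => j _.
by rewrite !mxE normCK.
Qed.

Lemma mxtrace_mul_adj_ge0 (C : numClosedFieldType) m n (A : 'M[C]_(m, n)) :
  0 <= \tr (A *m A ^t*).
Proof.
by rewrite mxtrace_mul_adj; do 2![apply: sumr_ge0 => ? _]; rewrite exprn_ge0.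
Qed.

Lemma mxtrace_mul_adj_eq0 (C : numClosedFieldType) m n (A : 'M[C]_(m, n)) :
  \tr (A *m A ^t*) = 0 -> A = 0.
Proof.
rewrite mxtrace_mul_adj => /psumr_eq0P A0; apply/matrixP => i j; rewrite mxE.
have A_ge0 k l : 0 <= `|A k l| ^+ 2 by rewrite exprn_ge0.
have /psumr_eq0P Ai0 := A0 (fun k _ => sumr_ge0 _ (fun l _ => A_ge0 k l)) i isT.
have /eqP := Ai0 (fun l _ => A_ge0 i l) j isT.
by rewrite expf_eq0 normr_eq0 => /eqP.
Qed.

Section QuantumStrategies.
Variable R : realType.
Local Notation C := R[i].

(** * Positive semidefinite matrices *)

Lemma psdmx_factor d (M : 'M[C]_d) : psdmx M -> exists N : 'M[C]_d, M = N ^t* *m N.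
Proof.
case=> M_adj M_ge0; set P := spectralmx M; set s := spectral_diag M.
have PP : P *m P ^t* = 1%:M by apply/unitarymxP/spectral_unitarymx.
have Mnormal : M \is normalmx by apply/normalmxP; rewrite M_adj.
have ME : M = P ^t* *m diag_mx s *m P.
  by rewrite -invmx_unitary ?spectral_unitarymx //; apply/orthomx_spectralP.
have s_ge0 i : 0 <= s 0 i.
  (* This vector is a unit eigenvector for the eigenvalue [s 0 i], so the quadratic form takes the
     value [s 0 i] there. *)
  have := M_ge0 (P ^t* *m delta_mx i 0).
  rewrite adjmxM adjmxK ME !mulmxA -(mulmxA _ P (P ^t*)) PP mulmx1.
  rewrite -(mulmxA _ P (P ^t*)) PP mulmx1 mul_mx_diag mxE (bigD1 i) //=.
  rewrite big1; last first.
    by move=> j /negPf ji; rewrite !mxE ji mulr0.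
  by rewrite !mxE !eqxx /= conjC1 mul1r mulr1 addr0.
exists (diag_mx (\row_i sqrtC (s 0 i)) *m P).
rewrite adjmxM !mulmxA -(mulmxA _ _ (diag_mx _)) [LHS]ME; congr (_ *m _ *m _).
apply/matrixP => i j; rewrite mul_mx_diag !mxE.
case: eqVneq => [->|ji]; last by rewrite !mulr0n conjC0 mul0r.
by rewrite !mulr1n conj_Creal ?ger0_real ?sqrtC_ge0 // -expr2 sqrtCK.
Qed.

Lemma psdmx_conj d e (M : 'M[C]_d) (P : 'M[C]_(d, e)) :
  psdmx M -> psdmx (P ^t* *m M *m P).
Proof.
case=> M_adj M_ge0; split=> [|v]; first by rewrite !adjmxM adjmxK M_adj mulmxA.
by have := M_ge0 (P *m v); rewrite adjmxM !mulmxA.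
Qed.

(** The quadratic form of the transpose at [v] is that of [M] at the entrywise conjugate of [v]. *)
Lemma psdmx_tr d (M : 'M[C]_d) : psdmx M -> psdmx M^T.
Proof.
case=> M_adj M_ge0; split=> [|v].
  by rewrite trmxK -{1}M_adj; apply/matrixP => i j; rewrite !mxE conjCK.
have := M_ge0 (map_mx Num.conj v); congr (_ <= _).
rewrite -[LHS]trace_mx11 -mxtrace_tr !trmx_mul mulmxA trace_mx11.
by congr ((_ *m _ *m _) _ _); apply/matrixP => i j; rewrite !mxE ?conjCK.
Qed.

Lemma mxtrace_psdmx_mul d (M N : 'M[C]_d) : psdmx M -> psdmx N ->
  0 <= \tr (M *m N) /\ (\tr (M *m N) = 0 -> M *m N = 0).
Proof.
move=> /psdmx_factor[A ->] /psdmx_factor[B ->].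
have trE : \tr (A ^t* *m A *m (B ^t* *m B)) =
           \tr ((A *m B ^t*) *m (A *m B ^t*) ^t*).
  by rewrite adjmxM adjmxK -mulmxA mxtrace_mulC -!mulmxA.
rewrite trE; split=> [|/mxtrace_mul_adj_eq0 AB0]; first exact: mxtrace_mul_adj_ge0.
by rewrite mulmxA -(mulmxA _ A) AB0 mulmx0 mul0mx.
Qed.

(** * Outcome probabilities and the criterion for winning with certainty *)

Lemma outcome_prob_ge0 d (psi : 'cV[C]_(d * d)) (E F : 'M[C]_d) :
  psdmx E -> psdmx F -> 0 <= outcome_prob psi E F.
Proof.
move=> /psdmx_factor[A ->] /psdmx_factor[B ->].
(* The probability is the squared norm of (A tensor B) psi. *)
rewrite /outcome_prob -tensmx_mul -adjmx_tens !mulmxA -adjmxM -mulmxA -trace_mx11.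
by rewrite mxtrace_mulC; apply: mxtrace_mul_adj_ge0.
Qed.

Lemma outcome_prob_suml d (psi : 'cV[C]_(d * d)) (I : finType) (E : I -> 'M[C]_d)
    (F : 'M[C]_d) :
  outcome_prob psi (\sum_i E i) F = \sum_i outcome_prob psi (E i) F.
Proof.
rewrite /outcome_prob -summxE -mulmx_suml -mulmx_sumr; congr ((_ *m _ *m _) _ _).
by apply/matrixP => i j; rewrite summxE !mxE summxE mulr_suml;
  apply: eq_bigr => k _; rewrite mxE.
Qed.

Lemma outcome_prob_sumr d (psi : 'cV[C]_(d * d)) (I : finType) (E : 'M[C]_d)
    (F : I -> 'M[C]_d) :
  outcome_prob psi E (\sum_i F i) = \sum_i outcome_prob psi E (F i).
Proof.
rewrite /outcome_prob -summxE -mulmx_suml -mulmx_sumr; congr ((_ *m _ *m _) _ _).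
by apply/matrixP => i j; rewrite summxE !mxE summxE mulr_sumr;
  apply: eq_bigr => k _; rewrite mxE.
Qed.

(** Reading the norm as an outcome probability lets the trace formula in the Schmidt bases also
    compute norms. *)
Lemma is_stateP d (psi : 'cV[C]_(d * d)) :
  is_state psi <-> outcome_prob psi 1%:M 1%:M = 1.
Proof.
have -> : outcome_prob psi 1%:M 1%:M = (psi ^t* *m psi) 0 0.
  rewrite /outcome_prob (_ : 1%:M *t 1%:M = 1%:M) ?mulmx1 //.
  apply/matrixP => i j; rewrite -(mxtens_unindexK i) -(mxtens_unindexK j).
  case: (mxtens_unindex i) (mxtens_unindex j) => [k l] [k' l'].
  by rewrite tensmxE !mxE (can_eq (@mxtens_indexK _ _)) xpair_eqE -natrM mulnb.
split=> [->|psi1]; first by rewrite mxE.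
by rewrite /is_state [LHS]mx11_scalar psi1.
Qed.

(** All outcome probabilities for a pair of questions add up to 1, so the defect from 1 is a sum of
    nonnegative losing terms weighted by [qdist]; it is zero exactly when every term is. *)
Lemma winning_prob_eq1 (S T A B : finType) (G : nonlocal_game R S T A B) d
    (psi : 'cV[C]_(d * d)) (E : S -> A -> 'M[C]_d) (F : T -> B -> 'M[C]_d) :
    is_state psi -> (forall s, is_measurement (E s)) ->
    (forall t, is_measurement (F t)) ->
  winning_prob G psi E F = 1 <->
  forall s t, 0 < qdist G s t -> forall a b, ~~ verif G a b s t ->
    outcome_prob psi (E s a) (F t b) = 0.
Proof.
move=> /is_stateP psi1 measE measF.
pose p s t a b := outcome_prob psi (E s a) (F t b).
have p_ge0 s t a b : 0 <= p s t a b.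
  by apply: outcome_prob_ge0; [case: (measE s) | case: (measF t)].
pose lose s t := \sum_a \sum_(b | ~~ verif G a b s t) p s t a b.
have lose_ge0 s t : 0 <= lose s t by do 2![apply: sumr_ge0 => ? _].
have q_ge0 s t : 0 <= (qdist G s t)%:C :> C by rewrite lecR qdist_ge0.
have winE : winning_prob G psi E F = 1 - \sum_s \sum_t (qdist G s t)%:C * lose s t.
  have -> : 1 = \sum_s \sum_t (qdist G s t)%:C :> C.
    by rewrite -[LHS](rmorph1 (@real_complex R)) -(qdist_sum1 G) rmorph_sum;
      apply: eq_bigr => s _; rewrite rmorph_sum.
  rewrite -sumrB; apply: eq_bigr => s _; rewrite -sumrB; apply: eq_bigr => t _.
  rewrite -[X in X - _]mulr1 -mulrBr; congr (_ * _); apply/esym/eqP.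
  rewrite subr_eq -big_split /= -psi1.
  rewrite -{1}(proj2 (measE s)) -(proj2 (measF t)) outcome_prob_suml.
  apply/eqP/eq_bigr => a _; rewrite outcome_prob_sumr.
  by rewrite (bigID (fun b => verif G a b s t)).
rewrite winE; split=> [/eqP|lose0].
  rewrite -[eqbRHS]subr0 (inj_eq (addrI _)) eqr_opp => /eqP win1 s t q_gt0 a b Vab.
  have term_ge0 s' t' : 0 <= (qdist G s' t')%:C * lose s' t' by apply: mulr_ge0.
  (* Applied to the four nested sums over [s], [t], [a] and [b], from the outside in. *)
  have sum0 (I : finType) (P : pred I) (f : I -> C) i :
      (forall i, 0 <= f i) -> P i -> \sum_(i | P i) f i = 0 -> f i = 0.
    by move=> f_ge0 Pi f0; apply: (psumr_eq0P (fun i _ => f_ge0 i) f0).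
  have /sum0 win_s : \sum_t (qdist G s t)%:C * lose s t = 0.
    by apply: sum0 win1 => // s'; apply: sumr_ge0.
  have /eqP := win_s t (term_ge0 s) isT.
  rewrite mulf_eq0 fmorph_eq0 (gt_eqF q_gt0) /= => /eqP lose0.
  have /sum0 lose_a : \sum_(b | ~~ verif G a b s t) p s t a b = 0.
    by apply: sum0 lose0 => // a'; apply: sumr_ge0.
  exact: lose_a.
rewrite [X in 1 - X]big1 ?subr0 // => s _; rewrite big1 // => t _.
(* Pairs that are never asked may be lost, but they carry weight zero. *)
have [->|q_neq0] := eqVneq (qdist G s t) 0; first by rewrite mul0r.
rewrite [lose s t]big1 ?mulr0 // => a _; rewrite big1 // => b Vab.
by apply: lose0 => //; rewrite lt0r q_neq0 qdist_ge0.
Qed.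

(** * The diagonal matrix of Schmidt coefficients *)

Lemma diag_real_mx_unit d (lambda : 'I_d -> R) : (forall i, 0 < lambda i) ->
  diag_mx (\row_i (lambda i)%:C : 'rV[C]_d) \in unitmx.
Proof.
move=> lambda_gt0; rewrite unitmxE det_diag unitfE; apply/prodf_neq0 => i _.
by rewrite mxE fmorph_eq0 gt_eqF.
Qed.

Lemma diag_real_mx_adj d (lambda : 'I_d -> R)
    (D := diag_mx (\row_i (lambda i)%:C : 'rV[C]_d)) :
  D ^t* = D.
Proof.
apply/matrixP => i j; rewrite !mxE.
case: eqVneq => [->|_]; last by rewrite !mulr0n conjC0.
by rewrite !mulr1n conj_Creal // complex_real.
Qed.

(** Entrywise, [lambda i ^+ 2] and [lambda j ^+ 2] agree wherever [M i j] is nonzero, and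
    nonnegative numbers with equal squares are equal. *)
Lemma comm_diag_sqr d (lambda : 'I_d -> R) (M : 'M[C]_d)
    (D := diag_mx (\row_i (lambda i)%:C : 'rV[C]_d)) :
  (forall i, 0 <= lambda i) -> D *m D *m M = M *m (D *m D) -> D *m M = M *m D.
Proof.
move=> lambda_ge0 /matrixP DDM; apply/matrixP => i j.
have := DDM i j; rewrite mulmxA -!(mulmxA D D) !(mul_diag_mx, mul_mx_diag) !mxE.
have [->|M_neq0] := eqVneq (M i j) 0; first by rewrite !(mulr0, mul0r).
rewrite !mulrA -(mulrA (M i j)) [LHS]mulrC => e; have := mulfI M_neq0 e => {e} /eqP.
rewrite -!expr2 -!rmorphXn /= (inj_eq (fmorph_inj _)) eqrXn2 // => /eqP ->.
by rewrite mulrC.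
Qed.

Lemma projective_of_disjoint (A B : finType) d (f : A -> B) (lambda : 'I_d -> R)
    (D := diag_mx (\row_i (lambda i)%:C : 'rV[C]_d))
    (X : A -> 'M[C]_d) (Y : B -> 'M[C]_d) :
    (forall i, 0 < lambda i) -> is_measurement X -> is_measurement Y ->
    (forall a b, b != f a -> X a *m D *m Y b = 0) ->
  forall b, is_projector (Y b) /\ D *m Y b = Y b *m D.
Proof.
move=> lambda_gt0 [Xpsd X1] [Ypsd Y1] XDY0.
have Dunit : D \in unitmx := diag_real_mx_unit lambda_gt0.
pose Z b := \sum_(a | f a == b) X a.
have Z1 : \sum_b Z b = 1%:M by rewrite -X1 (partition_big f predT).
have ZDY0 b b' : b' != b -> Z b *m D *m Y b' = 0.
  move=> b'b; rewrite !mulmx_suml big1 // => a /eqP fab.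
  by rewrite XDY0 ?fab.
have ZD b : Z b *m D = D *m Y b.
  (* Both sides collapse to this product: on the left after inserting the sum of the [Y b'], on the
     right after inserting the sum of the [Z b']. *)
  transitivity (Z b *m D *m Y b).
    rewrite -[LHS]mulmx1 -Y1 mulmx_sumr (bigD1 b) //= big1 ?addr0 //.
    exact: ZDY0.
  rewrite -[D in RHS]mul1mx -Z1 2![in RHS]mulmx_suml
    [RHS](bigD1 b) //= [X in _ + X]big1 ?addr0 // => b' b'b.
  by rewrite ZDY0 // eq_sym.
have Zadj b : (Z b) ^t* = Z b.
  apply/matrixP => i j; rewrite !mxE !summxE rmorph_sum; apply: eq_bigr => a _.
  by rewrite -[in RHS](proj1 (Xpsd a)) !mxE.
have DZ b : D *m Z b = Y b *m D.
  have := congr1 (fun M => M ^t*) (ZD b).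
  by rewrite !adjmxM Zadj (proj1 (Ypsd b)) diag_real_mx_adj.
have DY b : D *m Y b = Y b *m D.
  apply: comm_diag_sqr => [i|]; first exact: ltW.
  by rewrite -mulmxA -ZD !mulmxA DZ.
have ZY b : Z b = Y b by apply: (can_inj (mulmxK Dunit)); rewrite ZD DY.
move=> b; split=> //; split; first by case: (Ypsd b).
(* Expanding Y_b as the sum of all Y_b Y_b', the terms with b' distinct from b vanish, because D Y_b
   Y_b' = Z_b D Y_b' = 0 and D is invertible. *)
rewrite -[RHS]mulmx1 -Y1 mulmx_sumr (bigD1 b) //= big1 ?addr0 // => b' b'b.
by apply: (can_inj (mulKmx Dunit)); rewrite mulmxA DY -ZY ZDY0 // mulmx0.
Qed.

(** * Change of coordinates to the Schmidt bases *)

Definition family_mx d (alpha : 'I_d -> 'cV[C]_d) : 'M[C]_d :=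
  \matrix_(i, j) alpha j i 0.

Lemma family_mx_conjE d (alpha : 'I_d -> 'cV[C]_d) (E : 'M[C]_d) i j :
  ((family_mx alpha) ^t* *m E *m family_mx alpha) i j =
  ((alpha i) ^t* *m E *m alpha j) 0 0.
Proof.
rewrite !mxE; apply: eq_bigr => k _; rewrite !mxE; congr (_ * _).
by apply: eq_bigr => l _; rewrite !mxE.
Qed.

Lemma family_mx_unitary d (alpha : 'I_d -> 'cV[C]_d) : orthonormal_basis alpha ->
  (family_mx alpha) ^t* *m family_mx alpha = 1%:M.
Proof.
move=> ortho; apply/matrixP => i j.
by have := family_mx_conjE alpha 1%:M i j; rewrite !mulmx1 ortho => ->; rewrite mxE.
Qed.

Lemma tensmx_sandwich d (alpha beta alpha' beta' : 'cV[C]_d) (E F : 'M[C]_d) :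
  ((alpha ^t* *t beta ^t*) *m (E *t F) *m (alpha' *t beta')) 0 0 =
  (alpha ^t* *m E *m alpha') 0 0 * (beta ^t* *m F *m beta') 0 0.
Proof. by rewrite !tensmx_mul [LHS]mxE !ord1. Qed.

(** Expanding psi twice gives a double sum of lambda_i lambda_j <alpha_i|E|alpha_j>
    <beta_i|F|beta_j>. Both brackets carry their indices in the same order, so one matrix must be
    transposed for the sum to become a trace of a product. *)
Lemma outcome_prob_Schmidt d (psi : 'cV[C]_(d * d)) lambda alpha beta
    (E F : 'M[C]_d)
    (D := diag_mx (\row_i (lambda i)%:C : 'rV[C]_d))
    (U := family_mx alpha) (W := family_mx beta) :
  psi = \sum_i (lambda i)%:C *: (alpha i *t beta i) ->
  outcome_prob psi E F = \tr (U ^t* *m E *m U *m D *m (W ^t* *m F *m W)^T *m D).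
Proof.
move=> ->; rewrite /outcome_prob.
set psi' := (\sum_i _).
have -> : psi' ^t* =
    \sum_i (lambda i)%:C *: ((alpha i) ^t* *t (beta i) ^t*).
  apply/matrixP => k l; rewrite !mxE !summxE rmorph_sum; apply: eq_bigr => i _.
  by rewrite !mxE !rmorphM [X in X * _]conj_Creal ?complex_real.
rewrite !mulmx_suml summxE; apply: eq_bigr => i _.
rewrite mul_mx_diag [RHS]mxE [in RHS]mxE mulmx_sumr summxE mulr_suml.
apply: eq_bigr => j _.
rewrite -!scalemxAl -scalemxAr scalerA [LHS]mxE tensmx_sandwich
  -!family_mx_conjE -/U -/W.
by move: (U ^t* *m E *m U) (W ^t* *m F *m W) => X Y; rewrite mul_mx_diag !mxE; ring.
Qed.

Lemma is_measurement_conj (I : finType) d (E : I -> 'M[C]_d) (U : 'M[C]_d) :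
  U ^t* *m U = 1%:M -> is_measurement E ->
  is_measurement (fun i => U ^t* *m E i *m U).
Proof.
move=> U1 [Epsd E1]; split=> [i|]; first exact: psdmx_conj.
by rewrite -mulmx_suml -mulmx_sumr E1 mulmx1.
Qed.

Lemma is_measurement_tr (I : finType) d (E : I -> 'M[C]_d) :
  is_measurement E -> is_measurement (fun i => (E i)^T).
Proof.
move=> [Epsd E1]; split=> [i|]; first exact: psdmx_tr.
by rewrite -[RHS]trmx1 -E1 linear_sum.
Qed.

Lemma outcome_prob_Schmidt_eq0 d (psi : 'cV[C]_(d * d)) lambda alpha beta
    (E F : 'M[C]_d)
    (D := diag_mx (\row_i (lambda i)%:C : 'rV[C]_d))
    (U := family_mx alpha) (W := family_mx beta) :
    psi = \sum_i (lambda i)%:C *: (alpha i *t beta i) ->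
    (forall i, 0 < lambda i) -> psdmx E -> psdmx F ->
  outcome_prob psi E F = 0 <->
  U ^t* *m E *m U *m D *m (W ^t* *m F *m W)^T = 0.
Proof.
move=> psiE lambda_gt0 Epsd Fpsd.
rewrite (outcome_prob_Schmidt _ _ psiE) -/D -/U -/W.
split=> [tr0|->]; last by rewrite mul0mx mxtrace0.
have Xpsd := psdmx_conj U Epsd; have Ypsd := psdmx_tr (psdmx_conj W Fpsd).
(* Since D is self-adjoint, D Y D is positive semidefinite; the vanishing trace gives X D Y D = 0,
   and the last D is cancelled. *)
have := psdmx_conj D Ypsd; rewrite diag_real_mx_adj.
move=> /(mxtrace_psdmx_mul Xpsd) [_].
rewrite !mulmxA => /(_ tr0); apply: contra_eq => XDY.
by rewrite mulmx_free_eq0 // row_free_unit diag_real_mx_unit.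
Qed.

End QuantumStrategies.

Theorem theorem1 (R : realType) (S T A B : finType)
    (G : nonlocal_game R S T A B) (d : nat) (psi : 'cV[R[i]]_(d * d))
    (E : S -> A -> 'M[R[i]]_d) (F : T -> B -> 'M[R[i]]_d)
    (hproj : weakly_projective_for_Bob G)
    (hrank : full_Schmidt_rank psi)
    (hperfect : perfect_strategy G psi E F) :
  (forall t j, is_projector (F t j)) /\
  (exists Psi : 'cV[R[i]]_(d * d),
     maximally_entangled Psi /\ perfect_strategy G Psi E F).
Proof.
have [lambda [alpha [beta [[_ ortho_a ortho_b psiE] lambda_gt0]]]] := hrank.
have [psi1 measE measF /(winning_prob_eq1 G psi1 measE measF) lose0] := hperfect.
set U := family_mx alpha; set W := family_mx beta.
have UU : U ^t* *m U = 1%:M := family_mx_unitary ortho_a.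
have WW : W ^t* *m W = 1%:M := family_mx_unitary ortho_b.
have WWr := mulmx1C WW.
set D := diag_mx (\row_i (lambda i)%:C).
pose X s a := U ^t* *m E s a *m U; pose Y t b := (W ^t* *m F t b *m W)^T.
have measX s : is_measurement (X s) := is_measurement_conj UU (measE s).
have measY t : is_measurement (Y t) :=
  is_measurement_tr (is_measurement_conj WW (measF t)).
have XDY0 s t a b : 0 < qdist G s t -> ~~ verif G a b s t ->
    X s a *m D *m Y t b = 0.
  move=> q_gt0 /(lose0 s t q_gt0 a b).
  by move/(outcome_prob_Schmidt_eq0 psiE lambda_gt0 (proj1 (measE s) a)
    (proj1 (measF t) b)).
(* One suitable question [s] per [t] settles the structure of [Y t]; the commutation obtained from
   it later serves every question paired with [t]. *)
have projY t b : is_projector (Y t b) /\ D *m Y t b = Y t b *m D.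
  have [s [q_gt0 [f fP]]] := hproj t.
  apply: (projective_of_disjoint lambda_gt0 (measX s) (measY t) (f := f)) => a {}b bf.
  by apply: XDY0 => //; apply: contra bf => /fP ->.
split=> [t b|].
  have [[_ YY] _] := projY t b; split; first exact: proj1 (proj1 (measF t) b).
  (* Undoing the transpose and the change of basis carries idempotence back to [F t b]. *)
  have FE : F t b = W *m (Y t b)^T *m W ^t*.
    by rewrite trmxK !mulmxA WWr mul1mx -mulmxA WWr mulmx1.
  by rewrite FE -[in RHS]YY trmx_mul !mulmxA -(mulmxA _ (W ^t*)) WW mulmx1.
(* In dimension zero the norm of [psi] would be an empty sum, hence not 1. *)
have d_gt0 : (0 < d)%N.
  rewrite lt0n; apply: contra_eq_neq psi1 => d0; apply/eqP => /matrixP /(_ 0 0).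
  rewrite !mxE big1 => [/esym/eqP|[k k_lt] _]; first by rewrite oner_eq0.
  by exfalso; rewrite d0 in k_lt.
(* Chosen so that d c^2 = 1, which normalizes [Psi]. *)
pose c : R := Num.sqrt d%:R^-1.
have c_gt0 : 0 < c by rewrite sqrtr_gt0 invr_gt0 ltr0n.
(* Keeping the Schmidt bases of [psi] keeps [X] and [Y]; only [D] changes, into a scalar matrix. *)
pose Psi : 'cV[R[i]]_(d * d) := \sum_i c%:C *: (alpha i *t beta i).
have cD : diag_mx (\row_(_ < d) c%:C) = c%:C%:M :> 'M[R[i]]_d.
  by apply/matrixP => i j; rewrite !mxE.
have Psi1 : is_state Psi.
  apply/is_stateP; rewrite (outcome_prob_Schmidt (lambda := fun=> c) _ _ (erefl Psi)).
  rewrite cD !mulmx1 UU WW trmx1 mulmx1 mul1mx -scalar_mxM mxtrace_scalar.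
  rewrite -rmorphM -expr2 sqr_sqrtr ?invr_ge0 ?ler0n // -rmorphMn /= -[in LHS]mulr_natr.
  by rewrite mulVf ?rmorph1 // pnatr_eq0 -lt0n.
exists Psi; split.
  by split=> //; exists (fun=> c), alpha, beta; split=> //; split=> // i; apply: ltW.
split=> //; apply/(winning_prob_eq1 G Psi1 measE measF) => s t q_gt0 a b Vab.
apply/(outcome_prob_Schmidt_eq0 (lambda := fun=> c) (erefl Psi) (fun=> c_gt0)
  (proj1 (measE s) a) (proj1 (measF t) b)).
have [_ DY] := projY t b; have := XDY0 s t a b q_gt0 Vab.
rewrite -mulmxA DY mulmxA => XYD0; have XY0 : X s a *m Y t b = 0.
  by rewrite -(mulmxK (diag_real_mx_unit lambda_gt0) (X s a *m _)) XYD0 mul0mx.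
by rewrite cD mul_mx_scalar -scalemxAl -/(X s a) -/(Y t b) XY0 scaler0.
Qed.
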